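(* Let $\mathfrak g$ be a simple finite dimensional complex Lie algebra, $\delta:\mathfrak g[x]\to(\mathfrak g\otimes\mathfrak g)[x,y]$ a Lie bialgebra structure on $\mathfrak g[x]$ and $\overline\delta$ its extension to $\mathfrak g[[x]]$. Assume that $D(\mathfrak g[[x]],\overline\delta)\cong\mathfrak g\otimes A(0,\alpha)=\mathfrak g((x))$ with canonical form $(f_1|f_2)=\mathrm{Res}_{x=0}(K'(f_1,f_2)\,a(x))$, $a(x)=1+\sum_{i\ge1}a_ix^i\in\mathbb C[[x]]$, and let $\mathfrak g((x))=\mathfrak g[[x]]\oplus W$ be the corresponding Manin triple. Assume that $\sigma(x)\in\mathrm{Aut}_{\mathbb C[x]}(\mathfrak g[x])$ and a vertex $\alpha_i$ of the extended Dynkin diagram of $\mathfrak g$ are such that $\sigma(x)(W\cdot\mathbb C[[x^{-1}]])\subset\mathbb O_{\alpha_i}$. Then: - $\frac1{a(x)}$ is a polynomial of degree at most $2$ if $k_i=1$; - $\frac1{a(x)}$ is a polynomial of degree at most $1$ if $k_i>1$.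
   Context: Lie bialgebra structure: $\delta:L\to L\otimes L$ is a derivation into the $L$-module $L\otimes L$ inducing a Lie algebra structure on the dual space. For $L=\mathfrak g[[x]]$ one uses the topological tensor square $(\mathfrak g\otimes\mathfrak g)[[x,y]]$ and $L^*=$ the space of distributions (functionals vanishing on $x^m\mathfrak g[[x]]$ for some $m$). A structure $\delta$ on $\mathfrak g[x]$ extends to $\mathfrak g[[x]]$ by $\overline\delta(\sum a_nx^n)=\sum\delta(a_nx^n)$. The Drinfeld double $D(L,\delta)=L\oplus L^*$ carries the symmetric form with $L,L^*$ isotropic and $(a|f)=f(a)$, and the unique Lie bracket extending those of $L$ and $L^*$ and making the form invariant. The isomorphism $D(\mathfrak g[[x]],\overline\delta)\cong\mathfrak g((x))$ is a Lie algebra isomorphism identical on $\mathfrak g[[x]]$ carrying the canonical form (up to a nonzero scalar) to $\mathrm{Res}_{x=0}(K'(f_1,f_2)a(x))$, where $K'$ is the Killing form of $\mathfrak g((x))$ over $\mathbb C((x))$. $W$ is the image of $\mathfrak g[[x]]^*$: a Lagrangian subalgebra ($W=W^\perp$) complementary to $\mathfrak g[[x]]$. It is known that $W\subseteq x^N\mathfrak g[x^{-1}]$ for some $N$, so $W\subset\mathfrak g[x,x^{-1}]\subset\mathfrak g((x^{-1}))$, and $W\cdot\mathbb C[[x^{-1}]]$ is taken in $\mathfrak g((x^{-1}))$. $\mathrm{Aut}_{\mathbb C[x]}(\mathfrak g[x])$ (the $\mathbb C[x]$-linear Lie automorphisms) acts naturally on $\mathfrak g((x^{-1}))$. Fix a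 Cartan subalgebra $\mathfrak h$, root system $R$, simple roots $\alpha_1,\dots,\alpha_{\ell}$ ($\ell=\mathrm{rank}\,\mathfrak g$), maximal root $\alpha_{\max}=\sum_{j\ge 1} k_j\alpha_j$, $\alpha_0=-\alpha_{\max}$, $k_0=1$. For $h\in\mathfrak h(\mathbb R)$ put $\mathbb O_h=\mathfrak h[[x^{-1}]]\oplus\bigoplus_{\alpha\in R}M_\alpha(h)\mathfrak g_\alpha$, where $M_\alpha(h)=\{f\in\mathbb C((x^{-1})):v(f)\ge\alpha(h)\}$ and $v(\sum_{k\ge n}a_kx^{-k})=n$ if $a_n\ne0$. Let $h_0=0$ and, for $i\ge1$, let $h_i$ be defined by $\alpha_j(h_i)=\delta_{ij}/k_i$ ($j\ge1$). Then $\mathbb O_{\alpha_i}:=\mathbb O_{h_i}$. *)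

(* Defs.v *)
From HB Require Import structures.
From mathcomp Require Import all_boot all_order all_algebra.
From mathcomp Require Import boolp classical_sets functions fsbigop.

Set Implicit Arguments.
Unset Strict Implicit.
Unset Printing Implicit Defensive.
Import Order.TTheory GRing.Theory Num.Theory.
Local Open Scope classical_set_scope.
Local Open Scope ring_scope.

(* Infinite-dimensional spaces are represented as subsets of a function space,
   and maps between them are only constrained on those subsets. *)
Section LieGeneral.
Variable K : fieldType.

Definition linear_on (U V : lmodType K) (A : set U) (f : U -> V) : Prop :=
  forall (c : K) u v, A u -> A v -> f (c *: u + v) = c *: f u + f v.

Record lie_bracket_on (V : lmodType K) (A : set V) (b : V -> V -> V) : Prop := {
  lie_closed : forall u v, A u -> A v -> A (b u v);
  lie_linear_l : forall v, A v -> linear_on A (b^~ v);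
  lie_linear_r : forall u, A u -> linear_on A (b u);
  lie_alternating : forall u, A u -> b u u = 0;
  lie_jacobi : forall u v w, A u -> A v -> A w ->
    b u (b v w) + b v (b w u) + b w (b u v) = 0 }.

Record lie_iso (U V : lmodType K) (A : set U) (bA : U -> U -> U)
    (B : set V) (bB : V -> V -> V) (f : U -> V) : Prop := {
  iso_linear : linear_on A f;
  iso_bij : set_bij A B f;
  iso_bracket : forall u v, A u -> A v -> f (bA u v) = bB (f u) (f v) }.

Definition lspan (V : lmodType K) (S : set V) : set V :=
  [set v | exists s : seq (K * V),
     (forall p, p \in s -> S p.2) /\ v = \sum_(p <- s) p.1 *: p.2].

Definition simple_lie (g : vectType K) (br : g -> g -> g) : Prop :=
  [/\ lie_bracket_on [set: g] br,
      (exists x y, br x y != 0)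
    & forall I : {vspace g}, (forall x y, y \in I -> br x y \in I) ->
        I = 0%VS \/ I = fullv].

End LieGeneral.

Section Series.
Variable K : fieldType.

(* V[[x]] is [nat -> V]. *)
Definition poly_set (V : lmodType K) : set (nat -> V) :=
  [set f | exists N, forall n, (N <= n)%N -> f n = 0].

Definition mono (V : lmodType K) (n : nat) (v : V) : nat -> V :=
  fun m => if m == n then v else 0.

Definition pconv (U V Z : lmodType K) (m : U -> V -> Z)
    (f : nat -> U) (h : nat -> V) : nat -> Z :=
  fun n => \sum_(i < n.+1) m (f i) (h (n - i)%N).

(* V((x)) and V((x^-1)) both live in [int -> V], [f n] being the coefficient of
   x^n. *)
Definition laurent (V : lmodType K) : set (int -> V) :=
  [set f | exists N : int, forall n, n < N -> f n = 0].

Definition laurent_inf (V : lmodType K) : set (int -> V) :=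
  [set f | exists N : int, forall n, N < n -> f n = 0].

Definition power_inf (V : lmodType K) : set (int -> V) :=
  [set f | forall n : int, 0 < n -> f n = 0].

Definition embed (V : lmodType K) (f : nat -> V) : int -> V :=
  fun n => if n is Posz k then f k else 0.

Definition const_series (V : lmodType K) (v : V) : int -> V := embed (mono 0%N v).

(* The sum has finite support when the two factors both lie in Laurent series
   in x, or both in Laurent series in x^-1. *)
Definition conv (U V Z : lmodType K) (m : U -> V -> Z)
    (f : int -> U) (h : int -> V) : int -> Z :=
  fun n => \sum_(k \in [set: int]) m (f k) (h (n - k)).

Definition smul (V : lmodType K) : (int -> K^o) -> (int -> V) -> int -> V :=
  conv (fun (c : K^o) (v : V) => (c : K) *: v).

Definition inverse_is_poly (a : nat -> K^o) (d : nat) : Prop :=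
  exists p : {poly K}, (size p <= d.+1)%N /\
    pconv (fun u v : K^o => u * v : K^o) a (fun n => p`_n) = mono 0%N (1 : K^o).

End Series.

Section LieSeries.
Variables (K : fieldType) (g : vectType K) (br : g -> g -> g).

Local Notation e := (vbasis (fullv : {vspace g})).
Local Notation d := (\dim (fullv : {vspace g})).

Definition pbr : (nat -> g) -> (nat -> g) -> nat -> g := pconv br.
Definition lbr : (int -> g) -> (int -> g) -> int -> g := conv br.

(* g (x) g, in coordinates with respect to the basis e_p (x) e_q. *)
Definition tens (u v : g) : 'M[K]_d := \matrix_(p, q) (coord e p u * coord e q v).

Definition tmap (A B : g -> g) (t : 'M[K]_d) : 'M[K]_d :=
  \sum_p \sum_q t p q *: tens (A e`_p) (B e`_q).

(* (g (x) g)[[x,y]] is [nat -> nat -> 'M_d]. *)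
Definition poly2_set : set (nat -> nat -> 'M[K]_d) :=
  [set t | exists N, forall i j, (N <= i)%N || (N <= j)%N -> t i j = 0].

(* [a(x) (x) 1 + 1 (x) a(y), t(x,y)] *)
Definition act2 (a : nat -> g) (t : nat -> nat -> 'M[K]_d) :
    nat -> nat -> 'M[K]_d :=
  fun m n => \sum_(i < m.+1) tmap (br (a i)) id (t (m - i)%N n)
           + \sum_(j < n.+1) tmap id (br (a j)) (t m (n - j)%N).

(* (F (x) G)(t); the support is finite if t is a polynomial, or if F and G are
   distributions. *)
Definition pair2 (F G : (nat -> g) -> K^o) (t : nat -> nat -> 'M[K]_d) : K^o :=
  \sum_(ij \in [set: nat * nat]) \sum_p \sum_q
    t ij.1 ij.2 p q * F (mono ij.1 e`_p) * G (mono ij.2 e`_q).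

(* The full dual of g[x]; functionals are extended by 0 outside g[x] so that
   each one has a single representative. *)
Definition poly_dual : set ((nat -> g) -> K^o) :=
  [set F | linear_on (@poly_set K g) F /\ forall a, ~ poly_set a -> F a = 0].

Definition poly_dual_br (delta : (nat -> g) -> nat -> nat -> 'M[K]_d)
    (F G : (nat -> g) -> K^o) : (nat -> g) -> K^o :=
  fun a => if `[< poly_set a >] then pair2 F G (delta a) else 0.

Record lie_bialgebra (delta : (nat -> g) -> nat -> nat -> 'M[K]_d) : Prop := {
  cobr_poly : forall a, poly_set a -> poly2_set (delta a);
  cobr_linear : linear_on (@poly_set K g) delta;
  cobr_derivation : forall a b, poly_set a -> poly_set b ->
    delta (pbr a b) = act2 a (delta b) - act2 b (delta a);
  cobr_dual : lie_bracket_on poly_dual (poly_dual_br delta) }.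

(* The sum has finite support: delta (v x^n) tends to 0 as n grows, because
   delta is a derivation and g = [g, g]. *)
Definition cobr_ext (delta : (nat -> g) -> nat -> nat -> 'M[K]_d) :
    (nat -> g) -> nat -> nat -> 'M[K]_d :=
  fun a i j => \sum_(n \in [set: nat]) delta (mono n (a n)) i j.

Definition distribution : set ((nat -> g) -> K^o) :=
  [set F | linear_on [set: nat -> g] F /\
     exists m, forall a, (forall n, (n < m)%N -> a n = 0) -> F a = 0].

Definition distr_br (D : (nat -> g) -> nat -> nat -> 'M[K]_d)
    (F G : (nat -> g) -> K^o) : (nat -> g) -> K^o := fun a => pair2 F G (D a).

Definition pre_double : lmodType K :=
  ((nat -> g) * ((nat -> g) -> K^o))%type.

Definition double_set : set pre_double := [set u | distribution u.2].

Definition double_form (u v : pre_double) : K := u.2 v.1 + v.2 u.1.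

Record double_bracket (D : (nat -> g) -> nat -> nat -> 'M[K]_d)
    (B : pre_double -> pre_double -> pre_double) : Prop := {
  dbr_lie : lie_bracket_on double_set B;
  dbr_l : forall a b : nat -> g, B (a, 0) (b, 0) = (pbr a b, 0);
  dbr_dual : forall F G, distribution F -> distribution G ->
    B (0, F) (0, G) = (0, distr_br D F G);
  dbr_inv : forall u v w, double_set u -> double_set v -> double_set w ->
    double_form (B u v) w = double_form u (B v w) }.

(* The Killing form of g((x)) over K((x)): the trace of (ad f1)(ad f2),
   computed in the K((x))-basis of g((x)) given by the constants e_i. *)
Definition killing (f1 f2 : int -> g) : int -> K^o :=
  fun n => \sum_i coord e i (lbr f1 (lbr f2 (const_series e`_i)) n).

Definition res_form (a : nat -> K^o) (f1 f2 : int -> g) : K :=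
  smul (killing f1 f2) (embed a) (- 1).

Record double_iso (a : nat -> K^o) (B : pre_double -> pre_double -> pre_double)
    (Phi : pre_double -> int -> g) : Prop := {
  diso_lie : lie_iso double_set B (@laurent K g) lbr Phi;
  diso_id : forall f : nat -> g, Phi (f, 0) = embed f;
  diso_form : exists2 c : K, c != 0 &
    forall u v, double_set u -> double_set v ->
      res_form a (Phi u) (Phi v) = c * double_form u v }.

Definition manin_complement (Phi : pre_double -> int -> g) : set (int -> g) :=
  Phi @` [set u | double_set u /\ u.1 = 0].

Definition span_inf (W : set (int -> g)) : set (int -> g) :=
  lspan [set f | exists w c, [/\ W w, power_inf c & f = smul c w]].

Record poly_aut (sigma : (nat -> g) -> nat -> g) : Prop := {
  paut_iso : lie_iso (@poly_set K g) pbr (@poly_set K g) pbr sigma;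
  paut_linear : forall (p : nat -> K^o) (a : nat -> g),
    poly_set p -> poly_set a ->
    sigma (pconv (fun (c : K^o) v => (c : K) *: v) p a)
    = pconv (fun (c : K^o) v => (c : K) *: v) p (sigma a) }.

(* The K((x^-1))-linear extension of sigma to g((x^-1)). *)
Definition aut_inf (sigma : (nat -> g) -> nat -> g) (f : int -> g) : int -> g :=
  \sum_i smul (fun n => coord e i (f n) : K^o) (embed (sigma (mono 0%N e`_i))).

End LieSeries.

Section Roots.
Variables (K : numClosedFieldType) (g : vectType K) (br : g -> g -> g).

Definition commv (U V : {vspace g}) : {vspace g} :=
  (<<[seq br u v | u <- vbasis U, v <- vbasis V]>>)%VS.

Definition cartan (h : {vspace g}) : Prop :=
  [/\ (commv h h <= h)%VS,
      (exists n, iter n (commv h) h = 0%VS)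
    & forall x, (forall y, y \in h -> br x y \in h) -> x \in h].

Variable h : {vspace g}.

Local Notation hdual := 'Hom(subvs_of h, K^o).

Definition root_space (al : hdual) : set g :=
  [set x | forall t : subvs_of h, br (vsval t) x = (al t : K) *: x].

Definition is_root (al : hdual) : Prop :=
  al != 0 /\ exists2 x, x != 0 & root_space al x.

Definition simple_roots (ell : nat) (al : ell.-tuple hdual) : Prop :=
  [/\ basis_of fullv al,
      (forall j, is_root (tnth al j))
    & forall be, is_root be -> exists m : 'I_ell -> nat,
        be = \sum_j tnth al j *+ m j \/ be = - \sum_j tnth al j *+ m j].

Definition maximal_root (ell : nat) (al : ell.-tuple hdual) (th : hdual) : Prop :=
  is_root th /\
  forall be, is_root be ->
    (exists m : 'I_ell -> nat, be - th = \sum_j tnth al j *+ m j) -> be = th.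

Definition has_marks (ell : nat) (al : ell.-tuple hdual) (k : 'I_ell -> nat) :
    Prop :=
  maximal_root al (\sum_j tnth al j *+ k j).

(* Vertices of the extended Dynkin diagram; [None] is alpha_0. *)
Definition mark (ell : nat) (k : 'I_ell -> nat) (i : option 'I_ell) : nat :=
  if i is Some j then k j else 1%N.

Definition vertex_point (ell : nat) (al : ell.-tuple hdual) (k : 'I_ell -> nat)
    (i : option 'I_ell) (t : subvs_of h) : Prop :=
  if i is Some i' then
    forall j, tnth al j t = (j == i')%:R / (k i')%:R :> K
  else t = 0.

(* v(f) = n, where v is the valuation of K((x^-1)). *)
Definition val_inf (f : int -> K^o) (n : int) : Prop :=
  f (- n) != 0 /\ forall k, k < n -> f (- k) = 0.

(* M_al(t): v(f) >= al(t), with v(0) = +oo; al(t) is real for the points t of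
   interest. *)
Definition val_ge (r : K) : set (int -> K^o) :=
  [set f | laurent_inf f /\ forall n, val_inf f n -> r <= n%:~R].

Definition order_lattice (t : subvs_of h) : set (int -> g) :=
  lspan ([set f | power_inf f /\ forall n, f n \in h] `|`
         [set f | exists al m x,
            [/\ is_root al, val_ge (al t) m, root_space al x
              & f = fun n => (m n : K) *: x]]).

End Roots.

(* Main.v *)
(* Put b = 1/a, let K be the Killing form of g and O = O_(alpha_i); W is its own
   orthogonal. If u in g satisfies K(u, y_1) = 0 for all y in O (y_n being the
   coefficient of x^n), then for every w in W
     Res K'(b x^-2 sigma^-1(u), w) a = Res x^-2 K'(u, sigma(w)) = 0,
   because sigma preserves K'; hence b x^-2 sigma^-1(u) lies in W and b x^-2 u
   lies in O, which bounds the degree of b. For u in h this gives degree at most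
   2; for u in the root space of alpha_i with k_i > 1 the valuation alpha_i(h_i) =
   1/k_i > 0 improves the bound to 1.
   The same computation with x^0 instead of x^-2 puts b sigma^-1(u) in both W and
   g[[x]] as soon as K(u, y_-1) = 0 for all y in O, so that K is nondegenerate
   against O; this replaces the structure theory of g. *)
Require Import Defs.
From HB Require Import structures.
From mathcomp Require Import all_boot all_order all_algebra.
From mathcomp Require Import boolp classical_sets functions fsbigop reals.
From mathcomp Require Import complex zify.

Set Implicit Arguments.
Unset Strict Implicit.
Unset Printing Implicit Defensive.
Import Order.TTheory GRing.Theory Num.Theory.
Local Open Scope classical_set_scope.
Local Open Scope complex_scope.
Local Open Scope ring_scope.

(** * Biadditive maps *)

Definition biadditive (U V Z : zmodType) (m : U -> V -> Z) : Prop :=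
  (forall w, {morph m^~ w : x y / x + y}) /\ (forall u, {morph m u : x y / x + y}).

Section Biadditive.
Variables (U V Z : zmodType) (m : U -> V -> Z).
Hypothesis m_add : biadditive m.

Lemma biadd0l w : m 0 w = 0.
Proof. by apply: (addIr (m 0 w)); rewrite -m_add.1 !add0r. Qed.

Lemma biadd0r u : m u 0 = 0.
Proof. by apply: (addIr (m u 0)); rewrite -m_add.2 !add0r. Qed.

Lemma biadd_suml I (r : seq I) (P : pred I) F w :
  m (\sum_(i <- r | P i) F i) w = \sum_(i <- r | P i) m (F i) w.
Proof. exact: (big_morph (m^~ w) (m_add.1 w) (biadd0l w)). Qed.

Lemma biadd_sumr I (r : seq I) (P : pred I) F u :
  m u (\sum_(i <- r | P i) F i) = \sum_(i <- r | P i) m u (F i).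
Proof. exact: (big_morph (m u) (m_add.2 u) (biadd0r u)). Qed.

End Biadditive.

(** * Convolution of power series and of Laurent series *)

Section PowerSeries.
Variable K : fieldType.
Implicit Types U V X Y Z T : lmodType K.

Definition scal V (c : K^o) (v : V) : V := (c : K) *: v.
Definition mulo (c d : K^o) : K^o := c * d.

Lemma biadditive_scal V : biadditive (@scal V).
Proof. by split=> [w x y|u x y]; rewrite /scal ?scalerDl ?scalerDr. Qed.

Lemma biadditive_mulo : biadditive mulo.
Proof. by split=> [w x y|u x y]; rewrite /mulo ?mulrDl ?mulrDr. Qed.

(** Both sides sum over $j\le i\le n$; exchange the sums and replace $i$ by $i-j$. Four separate
    products are allowed so that scalar action, Killing form and multiplication of scalars can be
    mixed. *)
Lemma pconvA U V X Y Z T (m1 : X -> Z -> T) (m2 : U -> V -> X) (m3 : U -> Y -> T)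
    (m4 : V -> Z -> Y) f h l :
  biadditive m1 -> biadditive m3 ->
  (forall u v w, m1 (m2 u v) w = m3 u (m4 v w)) ->
  pconv m1 (pconv m2 f h) l = pconv m3 f (pconv m4 h l).
Proof.
move=> m1_add m3_add m_assoc; apply: funext => n; rewrite /pconv.
transitivity (\sum_(0 <= i < n.+1) \sum_(0 <= j < n.+1 | (j <= i)%N)
    m3 (f j) (m4 (h (i - j)%N) (l (n - i)%N))).
  rewrite big_mkord; apply: eq_bigr => i _; rewrite biadd_suml // big_mkord.
  rewrite (big_ord_narrow_leq (leq_ord i)).
  by apply: eq_bigr => j _; rewrite m_assoc.
rewrite (exchange_big_dep_nat predT) //= big_mkord; apply: eq_bigr => j _.
rewrite biadd_sumr //.
transitivity (\sum_(0 + j <= i < n.+1) m3 (f j) (m4 (h (i - j)%N) (l (n - i)%N))).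
  rewrite add0n [RHS](@big_nat_widenl _ _ _ j 0%N) //.
rewrite big_addn subSn ?leq_ord // big_mkord; apply: eq_bigr => i _.
by rewrite addnK addnC subnDA.
Qed.

Lemma pconvC V Z (m : V -> V -> Z) f h :
  (forall u v, m u v = m v u) -> pconv m f h = pconv m h f.
Proof.
move=> mC; apply: funext => n; rewrite /pconv (reindex_inj rev_ord_inj) /=.
by apply: eq_bigr => i _; rewrite mC subSS subKn // leq_ord.
Qed.

Lemma pconv_monor U V Z (m : U -> V -> Z) f v :
  biadditive m -> pconv m f (mono 0%N v) = fun n => m (f n) v.
Proof.
move=> m_add; apply: funext => n; rewrite /pconv big_ord_recr /= subnn /mono eqxx.
by rewrite big1 ?add0r // => i _; rewrite subn_eq0 leqNgt ltn_ord /= biadd0r.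
Qed.

Lemma pconv_monol U V Z (m : U -> V -> Z) u h :
  biadditive m -> pconv m (mono 0%N u) h = fun n => m u (h n).
Proof.
move=> m_add; apply: funext => n; rewrite /pconv big_ord_recl /= subn0 /mono eqxx.
by rewrite big1 ?addr0 // => i _; rewrite biadd0l.
Qed.

(** The first $n$ coefficients of $1/a$ for $a_0=1$. A list is built because each coefficient
    depends on all earlier ones. *)
Fixpoint inv_coefs (a : nat -> K^o) (n : nat) : seq K :=
  if n is n'.+1 then
    rcons (inv_coefs a n')
      ((n' == 0%N)%:R - \sum_(i < n') a (n' - i)%N * (inv_coefs a n')`_i)
  else [::].

Definition inv_series (a : nat -> K^o) : nat -> K^o := fun n => (inv_coefs a n.+1)`_n.

Lemma size_inv_coefs a n : size (inv_coefs a n) = n.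
Proof. by elim: n => //= n IHn; rewrite size_rcons IHn. Qed.

Lemma nth_inv_coefs a n i : (i < n)%N -> (inv_coefs a n)`_i = inv_series a i.
Proof.
elim: n => // n IHn; rewrite ltnS leq_eqVlt => /predU1P[-> //|lt_in].
by rewrite /= nth_rcons size_inv_coefs lt_in IHn.
Qed.

Lemma inv_seriesP (a : nat -> K^o) :
  a 0%N = 1 -> pconv mulo (inv_series a) a = mono 0%N (1 : K^o).
Proof.
move=> a0; apply: funext => n; rewrite /pconv big_ord_recr /= subnn a0 /mulo mulr1.
rewrite {2}/inv_series /= nth_rcons size_inv_coefs ltnn eqxx.
rewrite [X in _ - X](eq_bigr (fun i : 'I_n => inv_series a i * a (n - i)%N)).
  by rewrite addrC subrK /mono; case: (n == _).
by move=> i _; rewrite nth_inv_coefs // mulrC.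
Qed.

(* x^N f(x) *)
Definition shift V (N : int) (f : nat -> V) : int -> V := fun n => embed f (n - N).

Lemma shift_laurent V N (f : nat -> V) : laurent (shift N f).
Proof.
exists N => n; rewrite -subr_lt0 /shift.
by case: (n - N).
Qed.

Lemma laurentP V (f : int -> V) : laurent f -> exists N h, f = shift N h.
Proof.
case=> N fN; exists N, (fun j => f (N + j%:Z)); apply: funext => n.
rewrite /shift /embed; case E: (n - N) => [k|k].
  by rewrite -E addrC subrK.
by apply: fN; rewrite -subr_lt0 E.
Qed.

Lemma shift0 V (f : nat -> V) : shift 0 f = embed f.
Proof. by apply: funext => n; rewrite /shift subr0. Qed.

Lemma shift_add V N (f : nat -> V) j : shift N f (N + Posz j) = f j.
Proof. by rewrite /shift addrC addKr. Qed.

(** With [laurentP], this reduces sums over all integers to ordinary convolution of power series. *)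
Lemma conv_shift U V Z (m : U -> V -> Z) N M f h :
  biadditive m -> conv m (shift N f) (shift M h) = shift (N + M) (pconv m f h).
Proof.
move=> m_add; apply: funext => n; rewrite /conv /shift.
case E: (n - (N + M)) => [q|q] /=; last first.
  (* The exponents $k-N$ and $n-k-M$ have a negative sum, so one of the two factors vanishes. *)
  apply: fsbig1 => k _; case Ek: (k - N) => [j|j] /=; last exact: biadd0l.
  case El: (n - k - M) => [l|l] /=; [lia | exact: biadd0r].
(* Only $N\le k\le N+q$ can contribute. *)
rewrite (@fsbigE _ _ _ _ _ [seq N + Posz j | j <- iota 0 q.+1]) //; first last.
- move=> k _ kN; case Ek: (k - N) => [j|j] /=; last exact: biadd0l.
  case El: (n - k - M) => [l|l] /=; last exact: biadd0r.
  case/negP: kN; apply/mapP; exists j; last by lia.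
  by rewrite mem_iota; lia.
- by rewrite map_inj_uniq ?iota_uniq // => i j /addrI[].
rewrite [LHS](_ : _ = \sum_(k <- [seq N + Posz j | j <- iota 0 q.+1])
    m (embed f (k - N)) (embed h (n - k - M))); last first.
  by apply: eq_bigl => k; rewrite in_setT.
rewrite big_map -/(index_iota 0 q.+1) big_mkord /pconv; apply: eq_bigr => i _.
rewrite (_ : N + i%:Z - N = i%:Z); last by lia.
by rewrite (_ : n - (N + i%:Z) - M = (q - i)%N%:Z) //; have := ltn_ord i; lia.
Qed.

End PowerSeries.

(** * The Killing form of $\mathfrak g$ and the residue form *)

Section LieSeriesTheory.
Variables (K : fieldType) (g : vectType K) (br : g -> g -> g).
Hypothesis br_lie : lie_bracket_on [set: g] br.

Local Notation e := (vbasis (fullv : {vspace g})).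
Local Notation d := (\dim (fullv : {vspace g})).

Lemma br_linear_l w : linear_on [set: g] (br^~ w).
Proof. exact: (lie_linear_l br_lie). Qed.

Lemma br_linear_r u : linear_on [set: g] (br u).
Proof. exact: (lie_linear_r br_lie). Qed.

Lemma biadditive_br : biadditive br.
Proof.
split=> [w x y|u x y].
  by have := br_linear_l w 1 (I : [set: g] x) (I : [set: g] y); rewrite !scale1r.
by have := br_linear_r u 1 (I : [set: g] x) (I : [set: g] y); rewrite !scale1r.
Qed.

Lemma br0r u : br u 0 = 0. Proof. exact: biadd0r biadditive_br u. Qed.
Lemma br0l u : br 0 u = 0. Proof. exact: biadd0l biadditive_br u. Qed.

Lemma brZr u c v : br u (c *: v) = c *: br u v.
Proof.
have := br_linear_r u c (I : [set: g] v) (I : [set: g] 0).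
by rewrite !addr0 br0r addr0.
Qed.

Lemma brZl u c v : br (c *: u) v = c *: br u v.
Proof.
have := br_linear_l v c (I : [set: g] u) (I : [set: g] 0).
by rewrite !addr0 br0l addr0.
Qed.

Lemma brC u v : br u v = - br v u.
Proof.
apply/eqP; rewrite -addr_eq0; apply/eqP.
have := lie_alternating br_lie (I : [set: g] (u + v)).
rewrite !biadditive_br.1 !biadditive_br.2.
by rewrite !(lie_alternating br_lie (I : [set: g] _)) add0r addr0.
Qed.

Lemma basis_expand (v : g) : v = \sum_i coord e i v *: e`_i.
Proof. by rewrite -coord_vbasis ?memvf. Qed.

Lemma coord_basis_nat i (j : 'I_d) : coord e i e`_j = (i == j)%:R.
Proof. by rewrite coord_free ?(basis_free (vbasisP _)) // eq_sym. Qed.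

Lemma coord_eq (u v : g) : (forall i, coord e i u = coord e i v) -> u = v.
Proof.
by move=> uv; rewrite (basis_expand u) (basis_expand v); apply: eq_bigr => i _; rewrite uv.
Qed.

Definition ad_mx (u : g) : 'M[K]_d := \matrix_(j, l) coord e j (br u e`_l).

Lemma coord_br u v j : coord e j (br u v) = \sum_l ad_mx u j l * coord e l v.
Proof.
rewrite {1}(basis_expand v) (biadd_sumr biadditive_br) linear_sum.
by apply: eq_bigr => l _; rewrite brZr linearZ mxE mulrC.
Qed.

Lemma ad_mx_br x y : ad_mx (br x y) = ad_mx x *m ad_mx y - ad_mx y *m ad_mx x.
Proof.
apply/matrixP=> j l; rewrite !mxE.
have := lie_jacobi br_lie (I : [set: g] x) (I : [set: g] y) (I : [set: g] e`_l).
rewrite (brC e`_l x) (brC e`_l (br x y)) (_ : br y (- _) = - br y (br x e`_l)); last first.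
  by rewrite -scaleN1r brZr scaleN1r.
move/eqP; rewrite subr_eq0 => /eqP <-; rewrite linearB /= !coord_br.
by congr (_ - _); apply: eq_bigr => p _; rewrite [X in _ = _ * X]mxE.
Qed.

Definition kform (u v : g) : K^o := \sum_i coord e i (br u (br v e`_i)).

Lemma kform_tr u v : kform u v = \tr (ad_mx u *m ad_mx v).
Proof.
apply: eq_bigr => i _; rewrite coord_br mxE.
by apply: eq_bigr => j _; rewrite [X in _ = _ * X]mxE.
Qed.

Lemma kformC u v : kform u v = kform v u.
Proof. by rewrite !kform_tr mxtrace_mulC. Qed.

(** Since ad is a representation, this is $\mathrm{tr}([X,Y]Z)=\mathrm{tr}(X[Y,Z])$, by cyclicity of
    the trace. *)
Lemma kform_inv x y z : kform (br x y) z = kform x (br y z).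
Proof.
rewrite !kform_tr !ad_mx_br mulmxBl mulmxBr !linearB /= !mulmxA.
by rewrite -(mulmxA (ad_mx y)) (mxtrace_mulC (ad_mx y)).
Qed.

Lemma biadditive_kform : biadditive kform.
Proof.
split=> [w x y|u x y]; rewrite -big_split; apply: eq_bigr => i _ /=.
  by rewrite biadditive_br.1 linearD.
by rewrite biadditive_br.1 biadditive_br.2 linearD.
Qed.

Lemma kformZl c u v : kform (c *: u) v = c * kform u v.
Proof. by rewrite mulr_sumr; apply: eq_bigr => i _; rewrite brZl linearZ. Qed.

Lemma kformZr c u v : kform u (c *: v) = c * kform u v.
Proof. by rewrite kformC kformZl kformC. Qed.

(** The trace defining $K'$ is taken in a basis of constants, so $K'$ is the coefficientwise
    extension of the Killing form of $\mathfrak g$. *)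
Lemma killing_shift N M (f h : nat -> g) :
  killing br (shift N f) (shift M h) = shift (N + M) (pconv kform f h).
Proof.
apply: funext => n; rewrite /killing.
transitivity (\sum_i coord e i (shift (N + M) (pconv br f (fun n => br (h n) e`_i)) n)).
  apply: eq_bigr => i _; rewrite /lbr /const_series -shift0 (conv_shift _ _ _ _ biadditive_br).
  by rewrite (pconv_monor _ _ biadditive_br) (conv_shift _ _ _ _ biadditive_br) addr0.
rewrite /shift; case: (n - _) => [q|q] /=; last by rewrite big1 // => i _; rewrite linear0.
rewrite /pconv /kform exchange_big /=; apply: eq_bigr => i _.
by rewrite linear_sum.
Qed.

(** The factor $b$ comes out of $K'$ by bilinearity and cancels the weight $a$, leaving an
    unweighted residue. *)
Lemma res_form_shift (a b : nat -> K^o) N M (f h : nat -> g) :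
  pconv (@mulo K) b a = mono 0%N (1 : K^o) ->
  res_form br a (shift N (pconv (@scal K g) b f)) (shift M h)
  = shift (N + M) (pconv kform f h) (- 1).
Proof.
move=> ba1; have mulA := biadditive_mulo K; have kA := biadditive_kform.
have mulC u v : @mulo K u v = mulo v u by apply: mulrC.
rewrite /res_form /smul -shift0 killing_shift (conv_shift _ _ _ _ mulA) addr0.
suff -> : pconv (@mulo K) (pconv kform (pconv (@scal K g) b f) h) a = pconv kform f h by [].
rewrite (pconvA _ _ _ (m3 := @mulo K) (m4 := kform)) //; last exact: kformZl.
rewrite pconvC //.
rewrite -(pconvA _ _ _ (m1 := @mulo K) (m2 := @mulo K)) //; last first.
  by move=> u v w; rewrite /mulo mulrA.
rewrite (pconvC a b mulC) ba1 (pconv_monol _ _ mulA).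
by apply: funext => n; rewrite /mulo mul1r.
Qed.

(** * Elements of $\mathfrak g[x]$ as columns and matrices over $K[x]$ *)

Lemma poly_set_pconv (U V Z : lmodType K) (m : U -> V -> Z) f h :
  biadditive m -> poly_set f -> poly_set h -> poly_set (pconv m f h).
Proof.
move=> m_add [N fN] [M hM]; exists (N + M)%N => n le_n; apply: big1 => i _.
case: (leqP N i) => [/fN->|lt_i]; first exact: biadd0l.
by rewrite hM ?(biadd0r m_add) //; lia.
Qed.

Lemma poly_set_mono (V : lmodType K) n (v : V) : poly_set (mono n v).
Proof. by exists n.+1 => m lt_nm; rewrite /mono gtn_eqF. Qed.

Lemma poly_set_sum I (r : seq I) (F : I -> nat -> g) :
  (forall i, poly_set (F i)) -> poly_set (\sum_(i <- r) F i).
Proof.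
move=> F_poly; elim/big_ind: _ => //; first by exists 0%N.
move=> f h [N fN] [M hM]; exists (N + M)%N => n le_n.
by rewrite -[LHS]/(f n + h n) fN ?hM ?addr0 //; lia.
Qed.

Lemma linear_on_sum I (r : seq I) (F : I -> nat -> g) (s : (nat -> g) -> nat -> g) :
  linear_on (@poly_set K g) s -> (forall i, poly_set (F i)) ->
  s (\sum_(i <- r) F i) = \sum_(i <- r) s (F i).
Proof.
move=> s_lin F_poly; have poly0 : poly_set (0 : nat -> g) by exists 0%N.
elim: r => [|i r IHr]; last first.
  rewrite !big_cons -IHr -[F i in LHS]scale1r s_lin ?scale1r //.
  exact: poly_set_sum.
by rewrite !big_nil; have := s_lin (- 1) _ _ poly0 poly0; rewrite !scaleN1r !addNr.
Qed.

Lemma sum_seriesE (J : Type) (V : lmodType K) I (r : seq I) (F : I -> J -> V) n :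
  (\sum_(i <- r) F i) n = \sum_(i <- r) F i n.
Proof. by elim/big_rec2: _ => // i y f _ <-. Qed.

(** Some chosen bound for the support, not necessarily the least; the default 0 occurs only for
    series that are not polynomials. *)
Definition size_series (f : nat -> g) : nat :=
  xget 0%N [set N | forall n, (N <= n)%N -> f n = 0].

Lemma size_seriesP f n : poly_set f -> (size_series f <= n)%N -> f n = 0.
Proof. by move=> f_poly; apply: (xgetPex 0%N f_poly). Qed.

Definition col_poly (f : nat -> g) : 'cV[{poly K}]_d :=
  \col_i \poly_(n < size_series f) coord e i (f n).

Definition ad_poly (f : nat -> g) : 'M[{poly K}]_d :=
  \matrix_(i, j) \poly_(n < size_series f) ad_mx (f n) i j.

Lemma coef_col_poly f i j n : poly_set f -> (col_poly f i j)`_n = coord e i (f n).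
Proof.
by move=> f_poly; rewrite mxE coef_poly; case: ltnP => // /(size_seriesP f_poly)->; rewrite linear0.
Qed.

Lemma coef_ad_poly f i j n : poly_set f -> (ad_poly f i j)`_n = ad_mx (f n) i j.
Proof.
move=> f_poly; rewrite mxE coef_poly; case: ltnP => // /(size_seriesP f_poly)->.
by rewrite mxE br0l linear0.
Qed.

Lemma col_poly_br f h : poly_set f -> poly_set h ->
  col_poly (pbr br f h) = ad_poly f *m col_poly h.
Proof.
move=> f_poly h_poly; apply/matrixP=> i j; rewrite [RHS]mxE; apply/polyP=> n.
rewrite coef_col_poly; last exact: poly_set_pconv biadditive_br _ _.
rewrite coef_sum /pbr /pconv linear_sum /=.
under [RHS]eq_bigr => l _ do rewrite coefM.
rewrite exchange_big /=; apply: eq_bigr => p _; rewrite coord_br.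
by apply: eq_bigr => l _; rewrite coef_ad_poly // coef_col_poly.
Qed.

Lemma coef_tr_ad_poly f h n : poly_set f -> poly_set h ->
  (\tr (ad_poly f *m ad_poly h))`_n = pconv kform f h n.
Proof.
move=> f_poly h_poly; rewrite coef_sum.
under eq_bigr => i _.
  rewrite mxE coef_sum; under eq_bigr => j _ do rewrite coefM.
  rewrite exchange_big; over.
rewrite exchange_big; apply: eq_bigr => p _ /=; rewrite kform_tr.
apply: eq_bigr => i _; rewrite mxE; apply: eq_bigr => j _.
by rewrite !coef_ad_poly.
Qed.

Lemma col_poly_mono (l : 'I_d) : col_poly (mono 0%N e`_l) = delta_mx l 0.
Proof.
apply/matrixP=> i j; apply/polyP=> n.
rewrite coef_col_poly; last exact: poly_set_mono.
rewrite !mxE !ord1 eqxx andbT /mono; case: (eqVneq n 0%N) => [->|n0].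
  by rewrite coord_basis_nat; case: (i == l); rewrite ?coef1 ?coef0.
by rewrite linear0; case: (i == l); rewrite ?coef1 ?coef0 // (negbTE n0).
Qed.

(** * Automorphisms of $\mathfrak g[x]$ and their extension to series *)

Section Automorphism.
Variable sigma : (nat -> g) -> nat -> g.
Hypothesis sigma_aut : poly_aut br sigma.

(** The $K[[x]]$-linear extension of [sigma] to $\mathfrak g[[x]]$. *)
Definition aut_series (f : nat -> g) : nat -> g :=
  \sum_l pconv (@scal K g) (fun n => coord e l (f n)) (sigma (mono 0%N e`_l)).

Lemma aut_poly f : poly_set f -> poly_set (sigma f).
Proof. by move=> f_poly; have [] := iso_bij (paut_iso sigma_aut) => + _ _; apply. Qed.

Lemma aut_seriesE f : poly_set f -> aut_series f = sigma f.
Proof.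
move=> f_poly.
have cf_poly l : poly_set (fun n => coord e l (f n) : K^o).
  by case: f_poly => N fN; exists N => n /fN->; rewrite linear0.
have {2}-> : f = \sum_l pconv (@scal K g) (fun n => coord e l (f n)) (mono 0%N e`_l).
  apply: funext => n; rewrite {1}(basis_expand (f n)) sum_seriesE.
  by apply: eq_bigr => l _; rewrite (pconv_monor _ _ (biadditive_scal _)).
rewrite (linear_on_sum _ (iso_linear (paut_iso sigma_aut))).
  apply: eq_bigr => l _; rewrite (paut_linear sigma_aut) //; exact: poly_set_mono.
by move=> l; apply: poly_set_pconv (biadditive_scal _) _ _ => //; apply: poly_set_mono.
Qed.

Definition aut_mx : 'M[{poly K}]_d := \matrix_(j, l) col_poly (sigma (mono 0%N e`_l)) j 0.

Lemma col_poly_aut f : poly_set f -> col_poly (sigma f) = aut_mx *m col_poly f.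
Proof.
move=> f_poly; apply/matrixP=> i j; apply/polyP=> n.
rewrite coef_col_poly; last exact: aut_poly.
rewrite -aut_seriesE // mxE coef_sum /aut_series sum_seriesE linear_sum /=; apply: eq_bigr => l _.
rewrite mulrC coefM /pconv linear_sum; apply: eq_bigr => p _ /=.
rewrite [aut_mx _ _]mxE !coef_col_poly //; last exact/aut_poly/poly_set_mono.
by rewrite linearZ.
Qed.

(** This is $\sigma([f,e_l])=[\sigma(f),\sigma(e_l)]$, read column by column. *)
Lemma aut_mx_ad f : poly_set f -> aut_mx *m ad_poly f = ad_poly (sigma f) *m aut_mx.
Proof.
move=> f_poly; suff colE l : col l (aut_mx *m ad_poly f) = col l (ad_poly (sigma f) *m aut_mx).
  by apply/matrixP=> i l; have /matrixP/(_ i 0) := colE l; rewrite ![col _ _ _ _]mxE.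
have el_poly := poly_set_mono 0 e`_l.
have -> : col l (aut_mx *m ad_poly f) = col_poly (sigma (pbr br f (mono 0%N e`_l))).
  rewrite col_poly_aut; last exact: poly_set_pconv biadditive_br _ _.
  by rewrite col_poly_br // col_poly_mono mulmxA -colE.
rewrite (iso_bracket (paut_iso sigma_aut)) // col_poly_br; try exact: aut_poly.
rewrite [RHS]colE -mulmxA -colE; congr (_ *m _).
by apply/matrixP=> i j; rewrite [RHS]mxE [aut_mx _ _]mxE (ord1 j).
Qed.

Lemma aut_preimage f : poly_set f -> exists2 t, poly_set t & sigma t = f.
Proof.
by move=> f_poly; have [_ _ /(_ f f_poly)[t t_poly <-]] := iso_bij (paut_iso sigma_aut); exists t.
Qed.

(** Preimages of the constants $e_l$ give the columns of a right inverse, which is two-sided because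
    the matrices are square over a commutative ring. *)
Lemma aut_mx_inv : exists T, aut_mx *m T = 1%:M /\ T *m aut_mx = 1%:M.
Proof.
have ex l := aut_preimage (poly_set_mono 0 e`_l).
have /choice[t tP] : forall l : 'I_d, exists t, poly_set t /\ sigma t = mono 0%N e`_l.
  by move=> l; have [t] := ex l; exists t.
pose T : 'M[{poly K}]_d := \matrix_(i, l) col_poly (t l) i 0.
suff ST : aut_mx *m T = 1%:M by exists T; split=> //; apply: mulmx1C.
apply/matrixP=> i l; have [tl_poly sl] := tP l.
have /matrixP/(_ i 0) := col_poly_aut tl_poly; rewrite sl col_poly_mono !mxE andbT => ->.
by apply: eq_bigr => p _; congr (_ * _); rewrite mxE.
Qed.

(* The automorphism preserves traces of products of adjoint operators, so its
   inverse is its adjoint for the Killing form. *)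
Lemma kform_aut t u r (l : 'I_d) : poly_set t -> sigma t = mono 0%N u ->
  kform (t r) e`_l = kform u (sigma (mono 0%N e`_l) r).
Proof.
move=> t_poly st; have el_poly := poly_set_mono 0 e`_l; have kA := biadditive_kform.
have u_poly := poly_set_mono 0 u; have sl_poly := aut_poly el_poly.
have -> : kform (t r) e`_l = pconv kform t (mono 0%N e`_l) r by rewrite pconv_monor.
have -> : kform u (sigma (mono 0%N e`_l) r) = pconv kform (mono 0%N u) (sigma (mono 0%N e`_l)) r.
  by rewrite pconv_monol.
rewrite -!coef_tr_ad_poly //; congr (_`_r).
have [T [ST TS]] := aut_mx_inv.
have -> : ad_poly t = T *m (ad_poly (mono 0%N u) *m aut_mx).
  by rewrite -st -aut_mx_ad // mulmxA TS mul1mx.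
by rewrite -!mulmxA aut_mx_ad // mxtrace_mulC -!mulmxA ST mulmx1.
Qed.

(** Expanding the coefficients of $h$ in the basis reduces this to [kform_aut]. *)
Lemma pconv_kform_aut t u h n : poly_set t -> sigma t = mono 0%N u ->
  pconv kform t h n = kform u (aut_series h n).
Proof.
move=> t_poly st; have kA := biadditive_kform.
rewrite /aut_series sum_seriesE (biadd_sumr kA) /pconv.
under [RHS]eq_bigr => l _ do rewrite (biadd_sumr kA).
rewrite [RHS]exchange_big [LHS](reindex_inj rev_ord_inj); apply: eq_bigr => p _.
rewrite /= subSS subKn ?leq_ord // {1}(basis_expand (h p)) (biadd_sumr kA).
by apply: eq_bigr => l _; rewrite /scal !kformZr (kform_aut _ _ t_poly st).
Qed.

Lemma aut_inf_shift N f : aut_inf sigma (shift N f) = shift N (aut_series f).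
Proof.
apply: funext => n; rewrite /aut_inf sum_seriesE.
transitivity (\sum_l shift N
    (pconv (@scal K g) (fun n => coord e l (f n)) (sigma (mono 0%N e`_l))) n).
  apply: eq_bigr => l _; rewrite -shift0 -[N in RHS]addr0.
  rewrite -(conv_shift _ _ _ _ (biadditive_scal _)) /smul.
  congr (conv _ _ _ _); apply: funext => j; rewrite /shift /embed.
  by case: (j - N) => // q; rewrite linear0.
rewrite /shift /embed; case: (n - N) => q; last by rewrite big1.
by rewrite /aut_series sum_seriesE.
Qed.

(** The series $b=1/a$ is not yet known to be a polynomial, so linearity over $K[[x]]$ is required
    here, not only over $K[x]$. *)
Lemma aut_series_scal b t u : poly_set t -> sigma t = mono 0%N u ->
  aut_series (pconv (@scal K g) b t) = fun n => b n *: u.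
Proof.
move=> t_poly st; have sA := biadditive_scal g.
have -> : (fun n => b n *: u) = pconv (@scal K g) b (aut_series t).
  by rewrite aut_seriesE // st pconv_monor.
apply: funext => n; rewrite {1}/aut_series sum_seriesE.
transitivity (\sum_l pconv (@scal K g) b
   (pconv (@scal K g) (fun n => coord e l (t n)) (sigma (mono 0%N e`_l))) n).
  apply: eq_bigr => l _; rewrite -(pconvA (m1 := @scal K g) (m2 := @mulo K)) //; last first.
    by move=> x y z; rewrite /scal /mulo scalerA.
  congr (pconv _ _ _ _); apply: funext => m; rewrite /pconv linear_sum.
  by apply: eq_bigr => p _; rewrite linearZ.
rewrite /pconv exchange_big; apply: eq_bigr => p _ /=.
by rewrite /scal -scaler_sumr /aut_series sum_seriesE.
Qed.

End Automorphism.

(** * The Lagrangian complement $W$ *)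

Section ManinTriple.
Variable a : nat -> K^o.
Hypothesis a0 : a 0%N = 1.
Variables (B : pre_double g -> pre_double g -> pre_double g) (Phi : pre_double g -> int -> g).
Hypothesis Phi_iso : double_iso br a B Phi.

Local Notation W := (manin_complement Phi).
Local Notation b := (inv_series a).

Lemma complement_laurent w : W w -> laurent w.
Proof. by case=> u [uD _] <-; have [] := iso_bij (diso_lie Phi_iso) => + _ _; apply. Qed.

(** These functionals are the test elements of $\mathfrak g[[x]]^*$; together they separate the
    points of $\mathfrak g[[x]]$. *)
Lemma distribution_coord (j : 'I_d) n :
  distribution (fun q : nat -> g => coord e j (q n) : K^o).
Proof.
split=> [c u v _ _|]; first by rewrite -[(c *: u + v) n]/(c *: u n + v n) linearP.
by exists n.+1 => q q0; rewrite q0 // linear0.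
Qed.

(** The inclusion $W^\perp\subseteq W$. In the double, pairing $(p,F)$ with $(0,G)$ gives $G(p)$;
    letting $G$ run through the coefficient functionals forces $p=0$. *)
Lemma complement_perp f :
  laurent f -> (forall w, W w -> res_form br a f w = 0) -> W f.
Proof.
have [_ _ Phi_surj] := iso_bij (diso_lie Phi_iso).
move=> /Phi_surj[u uD <-] perp; exists u; split=> //.
have [c c0 Phi_form] := diso_form Phi_iso.
apply: funext => n; apply: coord_eq => j; rewrite linear0.
have vD : double_set (0, fun q : nat -> g => coord e j (q n) : K^o).
  exact: distribution_coord.
have := Phi_form _ _ uD vD; rewrite perp; last first.
  by eexists; last exact: erefl.
move/esym/eqP; rewrite mulf_eq0 (negbTE c0) /double_form /= => /eqP.
(* The remaining term of the form is the distribution [u.2] evaluated at 0. *)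
suff -> : u.2 0 = 0 by rewrite add0r.
have [u_lin _] := uD; have := u_lin (- 1) 0 0 I I.
by rewrite !scaleN1r !addNr.
Qed.

(** This is $W\cap\mathfrak g[[x]]=0$: [Phi] is injective and the identity on $\mathfrak g[[x]]$. *)
Lemma complement_series p : W (embed p) -> p = 0.
Proof.
have [_ Phi_inj _] := iso_bij (diso_lie Phi_iso).
have pD : double_set ((p, 0) : pre_double g).
  by split=> [c u v _ _|]; [rewrite scaler0 addr0 | exists 0%N].
case=> u [uD u1]; rewrite -(diso_id Phi_iso) => /Phi_inj up.
by rewrite -u1 up // inE.
Qed.

Lemma complement_sub_span w : W w -> span_inf W w.
Proof.
move=> Ww; exists [:: (1, w)]; split; last by rewrite big_seq1 scale1r.
move=> q; rewrite mem_seq1 => /eqP ->.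
exists w, (embed (mono 0%N (1 : K^o))); split=> //; first by case=> // -[].
have [M [f ->]] := laurentP (complement_laurent Ww).
rewrite /smul -shift0 (conv_shift _ _ _ _ (biadditive_scal _)) add0r.
rewrite (pconv_monol _ _ (biadditive_scal _)).
by congr (shift _ _); apply: funext => n; rewrite /scal scale1r.
Qed.

Variables (sigma : (nat -> g) -> nat -> g) (O : set (int -> g)).
Hypothesis sigma_aut : poly_aut br sigma.
Hypothesis sigma_O : aut_inf sigma @` span_inf W `<=` O.

Lemma aut_complement w : W w -> O (aut_inf sigma w).
Proof. by move=> Ww; apply: sigma_O; exists w => //; apply: complement_sub_span. Qed.

(* [K'(t, w) = K'(u, sigma w)], and multiplying [t] by [b = 1/a] cancels the
   weight [a] of the residue form. *)
Lemma complement_shift t u (s : int) : poly_set t -> sigma t = mono 0%N u ->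
  (forall y, O y -> kform u (y (s - 1)) = 0) ->
  W (shift (- s) (pconv (@scal K g) b t)).
Proof.
move=> t_poly st u_perp; apply: complement_perp; first exact: shift_laurent.
move=> w Ww; have := u_perp _ (aut_complement Ww).
have [M [f ->]] := laurentP (complement_laurent Ww).
rewrite res_form_shift; last exact: inv_seriesP.
rewrite aut_inf_shift /shift (_ : - 1 - (- s + M) = s - 1 - M); last by lia.
by case: (s - 1 - M) => q //=; rewrite (pconv_kform_aut sigma_aut _ _ t_poly st).
Qed.

(** For $s=0$ the element $b\,\sigma^{-1}(u)$ lies in $W\cap\mathfrak g[[x]]$ and so vanishes.
    Applying $\sigma$ gives $bu=0$, whose constant term is $u$ because $b_0=1$. *)
Lemma kform_nondegenerate u : (forall y, O y -> kform u (y (- 1)) = 0) -> u = 0.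
Proof.
move=> u_perp; have [t t_poly st] := aut_preimage sigma_aut (poly_set_mono 0 u).
have := complement_shift t_poly st (s := 0); rewrite oppr0 sub0r shift0.
move=> /(_ u_perp)/complement_series bt0.
have := aut_series_scal sigma_aut b t_poly st; rewrite bt0 /aut_series => /(congr1 (@^~ 0%N)).
rewrite sum_seriesE big1; last first.
  move=> l _; rewrite (_ : (fun n => _) = 0 :> (nat -> K^o)) /pconv.
    by rewrite big1 // => i _; rewrite /scal scale0r.
  by apply: funext => n; rewrite linear0.
by rewrite /inv_series /= big_ord0 subr0 scale1r.
Qed.

(** The vector $u$ puts $b\,x^{-2}u$ into $O$, and pairing with $u'$ then detects the coefficients
    of $b$. *)
Lemma inverse_poly_bound dg u u' :
  (forall y, O y -> kform u (y 1) = 0) -> kform u' u != 0 ->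
  (forall y (n : int), O y -> dg%:Z - 1 <= n -> kform u' (y n) = 0) ->
  inverse_is_poly a dg.
Proof.
move=> u_perp uu' u'_perp.
have [t t_poly st] := aut_preimage sigma_aut (poly_set_mono 0 u).
have /aut_complement := complement_shift t_poly st (s := 2) u_perp.
rewrite aut_inf_shift (aut_series_scal sigma_aut _ t_poly st) => Oy.
have b0 n : (dg < n)%N -> b n = 0.
  (* The coefficient $b_n$ stands at $x^{n-2}$, and $n>dg$ means $n-2\ge dg-1$. *)
  move=> lt_n; have := u'_perp _ (- 2 + n%:Z) Oy; rewrite shift_add kformZr.
  have -> : dg%:Z - 1 <= - 2 + n%:Z by lia.
  by move=> /(_ isT)/eqP; rewrite mulf_eq0 (negbTE uu') orbF => /eqP.
exists (\poly_(n < dg.+1) b n); split; first exact: size_poly.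
rewrite (_ : (fun n => _) = b); last first.
  by apply: funext => n; rewrite coef_poly; case: ltnP => // /b0.
rewrite -(inv_seriesP a0) pconvC // => x y; exact: mulrC.
Qed.

End ManinTriple.

Lemma kform_lspan u n (S : set (int -> g)) y : lspan S y ->
  (forall f, S f -> kform u (f n) = 0) -> kform u (y n) = 0.
Proof.
case=> s [sS ->] u_perp; rewrite sum_seriesE (biadd_sumr biadditive_kform).
by apply: big1_seq => p /andP[_ /sS/u_perp]; rewrite kformZr => ->; rewrite mulr0.
Qed.

End LieSeriesTheory.

(** * Root spaces, the Killing form and the lattices $\mathbb O_h$ *)

Section Roots.
Variables (K : numClosedFieldType) (g : vectType K) (br : g -> g -> g).
Hypothesis br_lie : lie_bracket_on [set: g] br.
Lemma mem_commv (U V : {vspace g}) u v : u \in U -> v \in V -> br u v \in commv br U V.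
Proof.
move=> uU vV; rewrite (coord_vbasis uU) (coord_vbasis vV).
rewrite (biadd_suml (biadditive_br br_lie)); apply: rpred_sum => i _.
rewrite (biadd_sumr (biadditive_br br_lie)); apply: rpred_sum => j _.
rewrite (brZl br_lie) (brZr br_lie); do 2!apply: rpredZ; apply: memv_span.
by apply: allpairs_f; apply: mem_nth; rewrite size_tuple.
Qed.

Variable h : {vspace g}.
Hypothesis h_cartan : cartan br h.

Local Notation hdual := 'Hom(subvs_of h, K^o).

Lemma root_neq0 (al : hdual) : al != 0 -> exists t, al t != 0.
Proof.
move=> al0; apply: contrapT => /forallNP al_eq0; case/negP: al0.
by apply/eqP/lfunP => t; rewrite lfunE /=; apply/eqP/negPn/negP.
Qed.

(** By invariance, moving $\mathrm{ad}\,t$ from $y$ to $x$ costs a factor $-\alpha(t)$. Choose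
    $\alpha(t)\ne0$; nilpotency of [h] makes $(\mathrm{ad}\,t)^n y=0$. *)
Lemma kform_cartan_root (al : hdual) x y :
  al != 0 -> root_space br al x -> y \in h -> kform br y x = 0.
Proof.
move=> /root_neq0[t t0] xal yh; have [_ [n h_nil] _] := h_cartan.
have iter_h m : iter m (br (vsval t)) y \in iter m (commv br h) h.
  by elim: m => //= m IHm; apply: mem_commv; rewrite ?subvsP.
have iter_k m : kform br (iter m (br (vsval t)) y) x = (- al t) ^+ m * kform br y x.
  elim: m => [|m IHm]; first by rewrite expr0 mul1r.
  rewrite iterS (brC br_lie) -scaleN1r (kformZl br_lie) (kform_inv br_lie) xal.
  by rewrite (kformZr br_lie) IHm exprS mulN1r -mulNr mulrA.
have := iter_h n; rewrite h_nil memv0 => /eqP iter0; have := iter_k n.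
rewrite iter0 (biadd0l (biadditive_kform br_lie)) => /esym/eqP.
by rewrite mulf_eq0 expf_eq0 oppr_eq0 (negbTE t0) andbF => /eqP.
Qed.

(** Invariance gives $(\alpha+\beta)(t)\,K(x,y)=0$ for every $t$. *)
Lemma kform_root_root (al be : hdual) x y :
  root_space br al x -> root_space br be y -> kform br x y != 0 -> be = - al.
Proof.
move=> xal ybe xy0; apply/lfunP => t; rewrite lfunE /=.
apply/eqP; rewrite -addr_eq0; apply/eqP/(mulIf xy0).
rewrite mul0r mulrDl -(kformZr br_lie) -(kformZl br_lie) -xal -ybe.
by rewrite (brC br_lie _ x) -scaleN1r (kformZl br_lie) (kform_inv br_lie) mulN1r addrN.
Qed.

(** The condition on $N$ expresses $N\le\lceil r\rceil$ without a ceiling function on [K]. A nonzero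
    coefficient at $x^n$ with $n>-N$ would make the valuation less than $N$. *)
Lemma val_ge_vanish (r : K) (m : int -> K^o) (n N : int) :
  val_ge r m -> (forall k : int, r <= k%:~R -> N <= k) -> - N < n -> m n = 0.
Proof.
move=> [[M m_eq0] r_le] r_N lt_n; apply/eqP/negPn/negP => mn0.
(* The support is bounded above, so there is a largest exponent $n+i$ with nonzero coefficient; the
   valuation is $-(n+i)$. *)
have [q lt_q] : exists q : nat, M <= n + q%:Z by exists `|M - n|%N; lia.
have ex_top : exists i : nat, m (n + i%:Z) != 0 by exists 0%N; rewrite addr0.
have top_le i : m (n + i%:Z) != 0 -> (i <= q)%N.
  move=> mi; rewrite leqNgt; apply/negP => lt_i; case/negP: mi; apply/eqP/m_eq0; lia.
case: (ex_maxnP ex_top top_le) => i mi i_max.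
have /r_le/r_N : val_inf m (- (n + i%:Z)).
  split=> [|k lt_k]; first by rewrite opprK.
  apply/eqP/negPn/negP => mk.
  have Ek : - k = n + `|- k - n|%N%:Z by lia.
  by have := i_max `|- k - n|%N; rewrite -Ek => /(_ mk); lia.
lia.
Qed.

Lemma order_lattice_perp (t : subvs_of h) u n y :
  order_lattice br t y ->
  (forall f, power_inf f -> f n \in h -> kform br u (f n) = 0) ->
  (forall be m x, is_root br be -> root_space br be x -> val_ge (be t) m ->
     kform br u x != 0 -> m n = 0) ->
  kform br u (y n) = 0.
Proof.
move=> Oy u_h u_root; apply: (kform_lspan br_lie Oy) => f.
case=> [[f_inf fh]|[be [m [x [be_root m_ge xbe ->]]]]]; first exact: u_h.
rewrite (kformZr br_lie); have [->|ux] := eqVneq (kform br u x) 0; first exact: mulr0.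
by rewrite (u_root _ _ _ be_root xbe m_ge ux) mul0r.
Qed.

(** The zero subalgebra is normalised by everything, so it is self-normalising only if $\mathfrak
    g=0$. *)
Lemma cartan_neq0 : (exists x y, br x y != 0) -> exists2 x, x \in h & x != 0.
Proof.
case=> x [y xy]; have [_ _ h_norm] := h_cartan.
have [h0|h0] := eqVneq h 0%VS; last by exists (vpick h); rewrite ?memv_pick ?vpick0.
have /h_norm : forall z, z \in h -> br x z \in h.
  by move=> z; rewrite h0 !memv0 => /eqP ->; rewrite (br0r br_lie).
by rewrite h0 memv0 => /eqP x0; rewrite x0 (br0l br_lie) eqxx in xy.
Qed.

End Roots.

(** * The two degree bounds *)

Theorem theorem4p11 (R : realType) (g : vectType R[i]) (br : g -> g -> g)
  (Hg : simple_lie br)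
  (delta : (nat -> g) ->
     nat -> nat -> 'M[R[i]]_(\dim (fullv : {vspace g})))
  (Hdelta : lie_bialgebra br delta)
  (a : nat -> R[i]^o) (Ha : a 0%N = 1)
  (B : pre_double g -> pre_double g -> pre_double g)
  (HB : double_bracket br (cobr_ext delta) B)
  (Phi : pre_double g -> int -> g)
  (HPhi : double_iso br a B Phi)
  (h : {vspace g}) (Hh : cartan br h)
  (ell : nat) (al : ell.-tuple 'Hom(subvs_of h, R[i]^o))
  (Hal : simple_roots br al)
  (k : 'I_ell -> nat) (Hk : has_marks br al k)
  (i : option 'I_ell) (hi : subvs_of h) (Hhi : vertex_point al k i hi)
  (sigma : (nat -> g) -> nat -> g) (Hsigma : poly_aut br sigma)
  (HW : aut_inf sigma @` span_inf (manin_complement Phi)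
        `<=` order_lattice br hi) :
  (mark k i = 1%N -> inverse_is_poly a 2) /\
  ((1 < mark k i)%N -> inverse_is_poly a 1).
Proof.
have [br_lie br_nonab _] := Hg.
have nondeg := kform_nondegenerate br_lie Ha HPhi Hsigma HW.
have bound := inverse_poly_bound br_lie Ha HPhi Hsigma HW.
split=> [_|].
  have [x xh x0] := cartan_neq0 br_lie Hh br_nonab.
  (* Elements of [h] pair to zero with root spaces, and the Cartan part of the lattice has no
     positive powers of $x$. *)
  have x_perp y n u : order_lattice br hi y -> 0 < n -> u \in h -> kform br u (y n) = 0.
    move=> Oy n0 uh; apply: (order_lattice_perp br_lie Oy).
      by move=> f f_inf _; rewrite f_inf // (biadd0r (biadditive_kform br_lie)).
    move=> be m z [be0 _] zbe _.
    by rewrite (kform_cartan_root br_lie Hh be0 zbe uh) eqxx.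
  (* Otherwise $x$ is orthogonal to [h] and to all root spaces, hence to the $x^{-1}$-coefficients
     of the lattice, and [nondeg] gives $x=0$. *)
  have [x' x'h xx'] : exists2 x', x' \in h & kform br x x' != 0.
    apply: contrapT => /forall2NP no_x'; case/negP: x0; apply/eqP/nondeg => y Oy.
    apply: (order_lattice_perp br_lie Oy).
      by move=> f _ fh; have [//|/negP/negPn/eqP] := no_x' (f (- 1)).
    move=> be m z [be0 _] zbe _.
    by rewrite (kform_cartan_root br_lie Hh be0 zbe xh) eqxx.
  apply: (bound 2%N x x') => [y Oy||y n Oy n1].
  - exact: x_perp.
  - by rewrite (kformC br_lie).
  - by apply: x_perp => //; lia.
(* The vertex $\alpha_0$ has mark 1, so the vertex is a simple root. *)
case: i Hhi => [i'|] //= Hi ki.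
have [_ al_root _] := Hal.
have [al0 [x x0 xal]] := al_root i'.
have hi_val : tnth al i' hi = (k i')%:R^-1 by rewrite Hi eqxx mul1r.
have ki0 : 0 < (k i')%:R :> R[i] by rewrite ltr0n; lia.
(* By [nondeg] again: $x$ is orthogonal to [h], so some root vector must pair with it; its root is
   then $-\alpha_i$. *)
have [be [x' [be_root xbe xx']]] : exists (be : 'Hom(subvs_of h, R[i]^o)) x',
    [/\ is_root br be, root_space br be x' & kform br x x' != 0].
  apply: contrapT => no_x'; case/negP: x0; apply/eqP/nondeg => y Oy.
  apply: (order_lattice_perp br_lie Oy) => [f _ fh|be m z be_root zbe _ xz].
    by rewrite (kformC br_lie) (kform_cartan_root br_lie Hh al0 xal fh).
  by case: no_x'; exists be, z.
have be_al := kform_root_root br_lie xal xbe xx'.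
have [be0 _] := be_root.
apply: (bound 1%N x x') => [y Oy||y n Oy n0].
- apply: (order_lattice_perp br_lie Oy) => [f _ fh|ga m z ga_root zga m_ge xz].
    by rewrite (kformC br_lie) (kform_cartan_root br_lie Hh al0 xal fh).
  (* Only the root $-\alpha_i$ pairs with $x$. There the valuation is an integer at least
     $-1/k_i>-1$, hence at least 0, so $x^1$ does not occur. *)
  apply: (val_ge_vanish m_ge (N := 0)) => // q.
  rewrite (kform_root_root br_lie xal zga xz) lfunE /= hi_val => le_q.
  suff : (- 1 : R[i]) < q%:~R by rewrite -mulrN1z ltr_int; lia.
  by apply: lt_le_trans le_q; rewrite ltrN2 invf_lt1 // ltr1n.
- by rewrite (kformC br_lie).
- apply: (order_lattice_perp br_lie Oy) => [f _ fh|ga m z ga_root zga m_ge xz].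
    by rewrite (kformC br_lie) (kform_cartan_root br_lie Hh be0 xbe fh).
  (* Only $\alpha_i$ pairs with [x']. There the valuation is at least $1/k_i>0$, hence at least 1,
     so no exponent $n\ge0$ occurs. *)
  apply: (val_ge_vanish m_ge (N := 1)) => [q|]; last by lia.
  rewrite (kform_root_root br_lie xbe zga xz) be_al opprK hi_val => le_q.
  suff : 0 < q%:~R :> R[i] by rewrite ltr0z; lia.
  by apply: lt_le_trans le_q; rewrite invr_gt0.
Qed.
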